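(* Let $0\le r<n$. If all eigenvalues of the random-to-random shuffle element $\upsilon_r\in\mathbb{C}S_r$ (acting, e.g., by left multiplication on $\mathbb{C}S_r$) are integers, then all eigenvalues of the Laplacian $\Lambda_r$ on $M_r$ are integers.
   Context: $\upsilon_r=r\cdot\mathrm{id}+\sum_{u<v}(v,u,u+1,\dots,v-1)+\sum_{u>v}(v,u,u-1,\dots,v+1)\in\mathbb{C}S_r$ (cycle notation); acting on words by permuting positions it sends $w$ to $\sum_{u,v=1}^r w^{(u\to v)}$, where $w^{(u\to v)}$ removes the letter in position $u$ and reinserts it at position $v$. $M_r$ ($0\le r\le n$) is the complex vector space with orthonormal basis the injective words of length $r$ on $\{1,\dots,n\}$, with boundary $\partial_r(a_1\cdots a_r)=\sum_{j=1}^r(-1)^{j-1}a_1\cdots\widehat{a_j}\cdots a_r$; $\delta_r$ is the adjoint of $\partial_{r+1}$ and $\Lambda_r=\delta_{r-1}\partial_r+\partial_{r+1}\delta_r$. *)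

(* Defs.v *)
From HB Require Import structures.
From mathcomp Require Import all_boot all_order all_algebra all_fingroup.
Set Implicit Arguments. Unset Strict Implicit. Unset Printing Implicit Defensive.
Import Order.TTheory GRing.Theory Num.Theory.
Local Open Scope ring_scope.

(* Matrix (over the basis T, enumerated via enum_val) of the linear operator
   whose coefficient of basis vector x in the image of basis vector y is F x y. *)
Definition fmx (C : nzRingType) (T : finType) (F : T -> T -> C) : 'M[C]_#|T| :=
  \matrix_(i, j) F (enum_val i) (enum_val j).

Definition is_integer (C : nzRingType) (x : C) : Prop := exists z : int, x = z%:~R.

Definition all_eigs_integral (C : fieldType) (m : nat) (A : 'M[C]_m) : Prop :=
  forall a : C, eigenvalue A a -> is_integer a.

(* The function underlying the cycle (v,u,u+1,...,v-1) for u<v,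
   (v,u,u-1,...,v+1) for u>v, and the identity for u = v. *)
Definition r2r_cycle (r : nat) (u v x : 'I_r) : nat :=
  if x == v then val u
  else if [&& (u < v)%N, (u <= x)%N & (x < v)%N] then (val x).+1
  else if [&& (v < u)%N, (v < x)%N & (x <= u)%N] then (val x).-1
  else val x.

(* Coefficient of the permutation s in
   upsilon_r = r id + sum_{u<v} (v,u,...,v-1) + sum_{u>v} (v,u,...,v+1)
             = sum_{u,v in [r]} c(u,v)   (with c(u,u) = id). *)
Definition upsilon_coef (C : nzRingType) (r : nat) (s : {perm 'I_r}) : C :=
  #|[set uv : 'I_r * 'I_r | [forall x, val (s x) == r2r_cycle uv.1 uv.2 x]]|%:R.

(* Matrix of left multiplication by upsilon_r on C S_r, in the basis S_r:
   coefficient of sigma in upsilon_r * tau is upsilon_r(sigma * tau^-1). *)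
Definition upsilon_left (C : nzRingType) (r : nat) : 'M[C]_#|{perm 'I_r}| :=
  fmx (fun sigma tau : {perm 'I_r} => upsilon_coef C (sigma * tau^-1)%g).

Notation inj_word n r := {t : r.-tuple 'I_n | uniq t}.

(* Coefficient of the word v in the boundary of the word w
   (partial(a_1...a_r) = sum_j (-1)^(j-1) a_1..^a_j..a_r, positions 0-indexed here). *)
Definition bdry_coef (C : nzRingType) (n : nat) (w v : seq 'I_n) : C :=
  \sum_(j < size w) (-1) ^+ j * ((take j w ++ drop j.+1 w == v)%:R).

(* Matrix of Lambda_r = delta_{r-1} partial_r + partial_{r+1} delta_r on M_r,
   where delta is the adjoint of partial w.r.t. the orthonormal basis of words
   (matrix coefficients are real, so the adjoint is the transpose).
   For r = 0, partial_0 = 0 (every word of W_{0.-1}=W_0 gets coefficient 0 from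
   the empty word since the defining sum is empty). *)
Definition laplacian (C : nzRingType) (n r : nat) : 'M[C]_#|{: inj_word n r}| :=
  fmx (fun w' w : inj_word n r =>
     \sum_(v : inj_word n r.-1)
        bdry_coef C (val (val w')) (val (val v)) * bdry_coef C (val (val w)) (val (val v))
   + \sum_(u : inj_word n r.+1)
        bdry_coef C (val (val u)) (val (val w')) * bdry_coef C (val (val u)) (val (val w))).

(* Main.v *)
Require Import Defs.
From mathcomp Require Import all_boot all_order all_algebra all_fingroup.
From mathcomp Require Import all_field.
From mathcomp Require Import ring zify.

(** Let [S_n] act on injective words through their letters and [S_r] through their
    positions. Expanding the Laplacian on a word [w], all terms that replace a letter of
    [w] by a letter outside [w] at another position cancel between the two summands, so
      Lambda_r = (r+1)(n-r) + U - Q,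
    where [U] is the random-to-random element twisted by the sign character and [Q] sums
    over the words obtained from [w] by replacing one letter in place. Sorting the
    transpositions of letters by how many of the two letters occur in [w] gives
      Q = T_n - T_r - C(n-r,2),
    with [T_n], [T_r] the sums of all transpositions of letters, respectively positions.
    The operators [U], [T_n], [T_r] commute, so it suffices that each has integer
    eigenvalues: for [U] this is the hypothesis, because restricting an eigenfunction to
    an [S_r]-orbit gives an eigenvector in the regular representation; for [T_n] and
    [T_r] an eigenvalue is an algebraic integer, and it is rational by taking traces on
    its eigenspace. *)

Set Implicit Arguments. Unset Strict Implicit. Unset Printing Implicit Defensive.
Import Order.TTheory GRing.Theory Num.Theory.
Local Open Scope ring_scope.

(** * Integrality and linear algebra over an algebraically closed field of characteristic zero *)

Lemma is_integerD (R : nzRingType) (x y : R) :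
  is_integer x -> is_integer y -> is_integer (x + y).
Proof. by move=> [a ->] [b ->]; exists (a + b); rewrite intrD. Qed.

Lemma is_integerN (R : nzRingType) (x : R) : is_integer x -> is_integer (- x).
Proof. by move=> [a ->]; exists (- a); rewrite mulrNz. Qed.

Lemma is_integer_nat (R : nzRingType) (k : nat) : is_integer (k%:R : R).
Proof. by exists k%:Z. Qed.

Section LinearAlgebra.
Variable C : numClosedFieldType.

Lemma eigenvalue_exists (m : nat) (A : 'M[C]_m) :
  (0 < m)%N -> exists a, eigenvalue A a.
Proof.
move=> m_gt0; have /closed_rootP[a Aa] : size (char_poly A) != 1%N.
  by rewrite size_char_poly eqSS -lt0n.
by exists a; rewrite eigenvalue_root_char.
Qed.

Lemma all_eigs_integralN (m : nat) (A : 'M[C]_m) :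
  all_eigs_integral A -> all_eigs_integral (- A).
Proof.
move=> intA a /eigenvalueP[v vA v_n0]; rewrite -[a]opprK.
apply/is_integerN/intA/eigenvalueP; exists v => //.
by rewrite scaleNr -vA mulmxN opprK.
Qed.

Lemma all_eigs_integral_scalar (m : nat) (c : C) :
  is_integer c -> all_eigs_integral (c%:M : 'M[C]_m).
Proof.
move=> intc a /eigenvalueP[v]; rewrite mul_mx_scalar => /eqP.
by rewrite -subr_eq0 -scalerBl scaler_eq0 subr_eq0 => /orP[/eqP <-|->].
Qed.

(* The eigenspace of [A + B] is stable under [A], so it contains a common eigenvector. *)
Lemma all_eigs_integralD (m : nat) (A B : 'M[C]_m) :
  A *m B = B *m A -> all_eigs_integral A -> all_eigs_integral B ->
  all_eigs_integral (A + B).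
Proof.
move=> AB intA intB a AB_a; set E := eigenspace (A + B) a.
have VAB : row_base E *m (A + B) = a *: row_base E.
  by apply/eigenspaceP; rewrite eq_row_base.
have /submxP[X VA] : (row_base E *m A <= row_base E)%MS.
  rewrite eq_row_base; apply/eigenspaceP.
  by rewrite -mulmxA mulmxDr AB -mulmxDl mulmxA VAB scalemxAl.
(* [X] is the matrix of [A] restricted to [E] in the basis [row_base E]; its eigenvector [u],
   expanded in that basis, is the common eigenvector. *)
have [|b /eigenvalueP[u uX u_n0]] := @eigenvalue_exists _ X.
  by rewrite lt0n mxrank_eq0.
have v_n0 : u *m row_base E != 0.
  apply: contra_neq u_n0 => uV0; apply: (row_free_inj (row_base_free E)).
  by rewrite uV0 mul0mx.
have vA : u *m row_base E *m A = b *: (u *m row_base E).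
  by rewrite -mulmxA VA mulmxA uX scalemxAl.
rewrite -(subrK b a) addrC; apply: is_integerD.
  by apply: intA; apply/eigenvalueP; exists (u *m row_base E).
apply: intB; apply/eigenvalueP; exists (u *m row_base E) => //.
rewrite -[B](addKr A) mulmxDr mulmxN vA -mulmxA VAB -scalemxAr.
by rewrite addrC scalerBl.
Qed.

(** Write P = LR with L of full column rank and R of full row rank. Cancelling L and R in LRLR = LR
    gives RL = 1, of size the rank, and the trace of LR is that of RL. *)
Lemma mxtrace_idempotent (m : nat) (P : 'M[C]_m) :
  P *m P = P -> \tr P = (\rank P)%:R.
Proof.
move=> PP; suff RL : row_base P *m col_base P = 1%:M.
  by rewrite -[in LHS](mulmx_base P) mxtrace_mulC RL mxtrace1.
apply: (row_free_inj (row_base_free P)).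
have : row_full (col_base P) by rewrite col_base_full.
rewrite /row_full => /eqP rkL.
have Ltfree : row_free (col_base P)^T by rewrite /row_free mxrank_tr rkL.
apply: trmx_inj; apply: (row_free_inj Ltfree) => /=.
rewrite -!trmx_mul mul1mx; congr _^T.
by rewrite -(mulmxA (row_base P)) mulmx_base mulmxA mulmx_base.
Qed.

(** The matrix (1 + A)/2 is idempotent, so the trace of A is twice a rank minus m. *)
Lemma mxtrace_involution (m : nat) (A : 'M[C]_m) :
  A *m A = 1%:M -> is_integer (\tr A).
Proof.
move=> AA; pose P := 2^-1 *: (1%:M + A).
have two_n0 : (2 : C) != 0 by rewrite pnatr_eq0.
have PP : P *m P = P.
  rewrite /P -scalemxAl -scalemxAr mulmxDl !mulmxDr !mul1mx mulmx1 AA.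
  rewrite [A + _]addrC -mulr2n -scaler_nat; congr (_ *: _).
  by rewrite scalerA mulVf // scale1r.
have -> : A = 2 *: P - 1%:M by rewrite /P scalerA divff // scale1r addrC addKr.
rewrite linearB linearZ /= mxtrace1 mxtrace_idempotent // -natrM.
by apply: is_integerD; [|apply: is_integerN]; apply: is_integer_nat.
Qed.

(** The eigenvalue is carried through [rat] to [algC]. There it is a root of a monic integer
    polynomial, and a rational algebraic integer is an integer. *)
Lemma rational_eigenvalue_integral (m : nat) (A : 'M[int]_m) (q : rat) :
  eigenvalue (map_mx intr A : 'M[C]_m) (ratr q) -> is_integer (ratr q : C).
Proof.
have map_ratr (K : numFieldType) :
    map_mx intr A = map_mx ratr (map_mx intr A : 'M[rat]_m) :> 'M[K]_m.
  by apply/matrixP=> i j; rewrite !mxE ratr_int.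
rewrite map_ratr eigenvalue_map -(eigenvalue_map (@ratr algC)) -map_ratr.
rewrite eigenvalue_root_char -map_char_poly => qA.
have : (ratr q : algC) \in Num.int.
  apply: Cint_rat_Aint; first by apply/CratP; exists q.
  apply: root_monic_Aint qA _ _; first by rewrite monic_map ?char_poly_monic.
  by apply/polyOverP=> i; rewrite coef_map /= intr_int.
case/intrP=> z qz; exists z; rewrite -ratr_int; congr ratr.
by apply: (fmorph_inj (@ratr algC)); rewrite /= qz ratr_int.
Qed.

End LinearAlgebra.

(** * The sum of all transpositions in an integral representation *)

Section TranspositionSum.
Variable n : nat.

Lemma sum_tperm_pairs (V : nmodType) (F : {perm 'I_n} -> V) :
  \sum_(ab : 'I_n * 'I_n | ab.1 != ab.2) F (tperm ab.1 ab.2) =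
  (\sum_(ab : 'I_n * 'I_n | (ab.1 < ab.2)%N) F (tperm ab.1 ab.2)) *+ 2.
Proof.
rewrite (bigID (fun ab : 'I_n * 'I_n => ab.1 < ab.2)%N) /= mulr2n; congr (_ + _).
  by apply: eq_bigl => -[a b] /=; rewrite -val_eqE neq_ltn; rewrite andbC; case: ltnP.
have swapI : involutive (fun ab : 'I_n * 'I_n => (ab.2, ab.1)) by case.
rewrite (reindex_inj (inv_inj swapI)); apply: eq_big => [] [a b] /=.
  by rewrite -val_eqE neq_ltn; case: ltngtP.
by rewrite tpermC.
Qed.

Variables (C : numClosedFieldType) (m : nat) (rho : {perm 'I_n} -> 'M[int]_m).
Hypothesis rho1 : rho 1%g = 1%:M.
Hypothesis rhoM : forall g h, rho (g * h)%g = rho g *m rho h.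

Local Notation rhoC g := (map_mx intr (rho g) : 'M[C]_m).

Definition tperm_sum : 'M[int]_m :=
  \sum_(ab : 'I_n * 'I_n | (ab.1 < ab.2)%N) rho (tperm ab.1 ab.2).

Lemma tperm_sum_central g : rho g *m tperm_sum = tperm_sum *m rho g.
Proof.
(* Conjugation permutes the ordered pairs of distinct points but need not preserve [a < b], so the
   argument is run on the doubled sum and halved entrywise. *)
suff /matrixP eq2 : rho g *m (tperm_sum *+ 2) = tperm_sum *+ 2 *m rho g.
  apply/matrixP=> i j; apply: (@mulIf _ 2) => //; rewrite !mulr_natr -!mulmxnE.
  by have := eq2 i j; rewrite !mulr2n mulmxDr mulmxDl.
rewrite -sum_tperm_pairs mulmx_sumr mulmx_suml.
have gI : injective (fun ab : 'I_n * 'I_n => (g ab.1, g ab.2)).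
  by move=> [a b] [c d] [] /perm_inj -> /perm_inj ->.
rewrite [LHS](reindex_inj gI); apply: eq_big => [] [a b] /=.
  by rewrite (inj_eq perm_inj).
by rewrite -!rhoM -tpermJ -conjgC.
Qed.

(* On an eigenspace of the central element [tperm_sum], the eigenvalue times the
   dimension is a sum of traces of involutions, so the eigenvalue is rational. *)
Lemma tperm_sum_integral :
  all_eigs_integral (map_mx intr tperm_sum : 'M[C]_m).
Proof.
move=> a Ta; set E := eigenspace (map_mx intr tperm_sum) a; pose V := row_base E.
have VT : V *m map_mx intr tperm_sum = a *: V.
  by apply/eigenspaceP; rewrite eq_row_base.
(* The eigenspace is stable under [rho g] by centrality, and [V *m rhoC g *m pinvmx V] is the matrix
   of the restriction in the basis [V]. *)
have VS g : V *m rhoC g *m pinvmx V *m V = V *m rhoC g.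
  apply: mulmxKpV; rewrite /V eq_row_base; apply/eigenspaceP.
  by rewrite -mulmxA -map_mxM tperm_sum_central map_mxM mulmxA VT scalemxAl.
have S_invol ab : is_integer (\tr (V *m rhoC (tperm ab.1 ab.2) *m pinvmx V)).
  apply: mxtrace_involution; apply: (row_free_inj (row_base_free E)).
  rewrite -/V -[LHS]mulmxA VS mulmxA VS -mulmxA -map_mxM -rhoM tperm2 rho1.
  by rewrite map_mx1 mulmx1 mul1mx.
have trT : a *+ \rank E =
    \sum_(ab : 'I_n * 'I_n | (ab.1 < ab.2)%N)
      \tr (V *m rhoC (tperm ab.1 ab.2) *m pinvmx V).
  rewrite -mxtrace_scalar -raddf_sum; congr mxtrace.
  apply: (row_free_inj (row_base_free E)); rewrite -/V /= mul_scalar_mx -VT.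
  rewrite /tperm_sum raddf_sum mulmx_sumr mulmx_suml.
  by apply: eq_bigr => ab _; rewrite VS.
have [z az] : is_integer (a *+ \rank E).
  rewrite trT; apply: big_ind => [|x y|ab _]; first exact: (is_integer_nat C 0).
    exact: is_integerD.
  exact: S_invol.
have [q aq] : exists q : rat, a = ratr q.
  exists (z%:~R / (\rank E)%:R).
  have rk_n0 : (\rank E)%:R != 0 :> C by rewrite pnatr_eq0 mxrank_eq0.
  apply: (mulIf rk_n0); rewrite mulr_natr az rmorphM fmorphV /= ratr_int ratr_nat.
  by rewrite divfK.
by rewrite aq in Ta *; apply: rational_eigenvalue_integral Ta.
Qed.

End TranspositionSum.

(** * Matrices of operators indexed by a finite type *)

Section OperatorMatrices.

Lemma sum_enum_val (V : nmodType) (T : finType) (F : T -> V) :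
  \sum_(i < #|T|) F (enum_val i) = \sum_x F x.
Proof. by rewrite [RHS](reindex _ (onW_bij _ (@enum_val_bij T))). Qed.

(** Eigenvectors are rows here, so [f] is a function on the basis, on which the transposed operator
    acts. *)
Lemma fmx_eigenvalueP (K : fieldType) (T : finType) (F : T -> T -> K) (a : K) :
  reflect (exists2 f : T -> K, forall y, \sum_x f x * F x y = a * f y
                             & exists x, f x != 0)
          (eigenvalue (fmx F) a).
Proof.
apply: (iffP eigenvalueP) => [[v vF v_n0]|[f fF [x fx_n0]]].
  exists (fun x => v 0 (enum_rank x)) => [y|].
    have /rowP/(_ (enum_rank y)) := vF; rewrite !mxE => <-.
    rewrite -sum_enum_val; apply: eq_bigr => i _.
    by rewrite mxE enum_valK enum_rankK.
  by have /rV0Pn[i vi_n0] := v_n0; exists (enum_val i); rewrite enum_valK.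
exists (\row_i f (enum_val i)).
  apply/rowP=> j; rewrite !mxE -fF -[RHS]sum_enum_val.
  by apply: eq_bigr => i _; rewrite !mxE.
by apply/rV0Pn; exists (enum_rank x); rewrite mxE enum_rankK.
Qed.

Definition funmx (K : nzRingType) (T : finType) (f : T -> T) : 'M[K]_#|T| :=
  fmx (fun x y => (x == f y)%:R).

Lemma map_funmx (T : finType) (f : T -> T) (K : nzRingType) :
  map_mx intr (funmx int f) = funmx K f.
Proof. by apply/matrixP=> i j; rewrite !mxE rmorph_nat. Qed.

Lemma funmx_comp (K : nzRingType) (T : finType) (f g : T -> T) :
  funmx K (f \o g) = funmx K f *m funmx K g.
Proof.
apply/matrixP=> i j; rewrite !mxE /= (bigD1 (enum_rank (g (enum_val j)))) //=.
rewrite !mxE enum_rankK eqxx mulr1 big1 ?addr0 // => k.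
by rewrite -(inj_eq enum_val_inj) enum_rankK !mxE => /negPf ->; rewrite mulr0.
Qed.

Lemma eq_funmx (K : nzRingType) (T : finType) (f g : T -> T) :
  f =1 g -> funmx K f = funmx K g.
Proof. by move=> fg; apply/matrixP=> i j; rewrite !mxE fg. Qed.

Lemma funmx_id (K : nzRingType) (T : finType) (f : T -> T) :
  f =1 id -> funmx K f = 1%:M.
Proof.
by move=> f1; apply/matrixP=> i j; rewrite !mxE f1 (inj_eq enum_val_inj).
Qed.

Lemma sum_eq_indicator (K : nzRingType) (T : finType) (F : T -> K) (x : T) :
  \sum_y F y * (y == x)%:R = F x.
Proof.
rewrite (bigD1 x) //= eqxx mulr1 big1 ?addr0 // => y /negPf ->.
by rewrite mulr0.
Qed.

End OperatorMatrices.

(** * Injective words as injective functions on positions, and their faces *)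

Section Words.
Variable n : nat.

Definition letter r (w : inj_word n r) (i : 'I_r) : 'I_n := tnth (val w) i.

Lemma letter_inj r (w : inj_word n r) : injective (letter w).
Proof. exact/tuple_uniqP/(valP w). Qed.

Lemma eq_word r (w w' : inj_word n r) : letter w =1 letter w' -> w = w'.
Proof. by move=> ww'; apply/val_inj/eq_from_tnth. Qed.

Lemma mkword_subproof r (f : 'I_r -> 'I_n) :
  injective f -> uniq [tuple f i | i < r].
Proof. by move=> fI; rewrite map_inj_uniq ?enum_uniq. Qed.

Definition mkword r (f : 'I_r -> 'I_n) (fI : injective f) : inj_word n r :=
  Sub [tuple f i | i < r] (mkword_subproof fI).

Lemma letter_mkword r (f : 'I_r -> 'I_n) (fI : injective f) i :
  letter (mkword fI) i = f i.
Proof. by rewrite /letter tnth_mktuple. Qed.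

Definition face r (w : inj_word n r.+1) (j : 'I_r.+1) : inj_word n r :=
  mkword (inj_comp (@letter_inj _ w) (@lift_inj _ j)).

Lemma letter_face r (w : inj_word n r.+1) j k :
  letter (face w j) k = letter w (lift j k).
Proof. exact: letter_mkword. Qed.

Lemma face_eq r (u v : inj_word n r.+1) i :
  face u i = face v i -> letter u i = letter v i -> u = v.
Proof.
move=> uv_face uv_i; apply: eq_word => k.
case: (unliftP i k) => [k' ->|-> //]; by rewrite -!letter_face uv_face.
Qed.

Lemma insert_letter r (w : inj_word n r) (i : 'I_r.+1) (a : 'I_n) :
  (forall k, letter w k != a) -> exists2 u, face u i = w & letter u i = a.
Proof.
move=> w_a.
pose f k := if unlift i k is Some k' then letter w k' else a.
have fI : injective f.
  move=> k l; rewrite /f; case: unliftP => [k' ->|->]; case: unliftP => [l' ->|->] //.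
  - by move/letter_inj ->.
  - by move/eqP; rewrite (negPf (w_a _)).
  - by move/esym/eqP; rewrite (negPf (w_a _)).
exists (mkword fI); last by rewrite letter_mkword /f unlift_none.
by apply: eq_word => k; rewrite letter_face letter_mkword /f liftK.
Qed.

Lemma face_seq r (w : inj_word n r.+1) (j : 'I_r.+1) :
  take j (val (val w)) ++ drop j.+1 (val (val w)) = val (val (face w j)).
Proof.
set s := val (val w); have sz : size s = r.+1 by rewrite size_tuple.
pose a0 := letter w j.
have sz_take : size (take j s) = j by rewrite size_take sz ltn_ord.
apply: (@eq_from_nth _ a0) => [|k].
  by rewrite size_cat size_drop sz_take sz size_tuple; have := ltn_ord j; lia.
rewrite size_cat size_drop sz_take sz => k_lt.
have k_r : (k < r)%N by have := ltn_ord j; lia.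
have -> : nth a0 (val (val (face w j))) k = letter (face w j) (Ordinal k_r).
  by rewrite /letter (tnth_nth a0).
rewrite letter_face /letter (tnth_nth a0) /= nth_cat sz_take /bump.
case: ltnP => k_j; first by rewrite nth_take // add0n.
by rewrite nth_drop; congr nth; lia.
Qed.

Lemma bdry_coefE (K : nzRingType) r (w : inj_word n r.+1) (v : inj_word n r) :
  bdry_coef K (val (val w)) (val (val v)) =
  \sum_(j < r.+1) (-1) ^+ j * (face w j == v)%:R.
Proof.
rewrite /bdry_coef size_tuple; apply: eq_bigr => j _.
by rewrite face_seq.
Qed.

(** A word in the fibre is determined by its letter at [i], which can be any letter that does not
    occur in [w]. *)
Lemma card_face_fiber r (w : inj_word n r) (i : 'I_r.+1) :
  #|[set u | face u i == w]| = (n - r)%N.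
Proof.
have letI : {in [set u | face u i == w] &, injective (fun u => letter u i)}.
  move=> u v; rewrite !inE => /eqP uw /eqP vw; apply: face_eq.
  by rewrite uw vw.
rewrite -(card_in_imset letI) (_ : _ @: _ = ~: (letter w @: setT)).
  rewrite cardsCs setCK card_imset ?cardsT ?card_ord //.
  exact: letter_inj.
apply/setP=> a; rewrite inE; apply/imsetP/idP => [[u]|w_a].
  rewrite inE => /eqP <- ->; apply/imsetP => -[k _].
  by rewrite letter_face => /letter_inj/eqP; rewrite (negPf (neq_lift _ _)).
have [|u uw ua] := @insert_letter _ w i a; last by exists u; rewrite ?inE ?uw.
by move=> k; apply: contraNneq w_a => <-; apply: imset_f.
Qed.

(** [w'] arises from [w] by deleting the letter at [q] and inserting at [p] a different one, which
    by injectivity of [w'] lies outside [w]. *)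
Definition pivot r (w' w : inj_word n r.+1) (p q : 'I_r.+1) : bool :=
  (face w' p == face w q) && (letter w' p != letter w q).

Lemma pivotC r (w' w : inj_word n r.+1) p q : pivot w' w p q = pivot w w' q p.
Proof. by rewrite /pivot eq_sym [letter w q == _]eq_sym. Qed.

(** The deleted positions are i = p and j = q + 1, so i < j. Deleting both from [u] gives face [q]
    of [w'] and face [p] of [w]. Conversely [u] must be [w'] with the letter of [w] at [p] inserted
    at [i]. *)
Lemma card_face_pair r (w' w : inj_word n r.+1) (p q : 'I_r.+1) : (p <= q)%N ->
  #|[set u | (face u (widen_ord (leqnSn _) p) == w') && (face u (lift ord0 q) == w)]|
  = pivot w' w q p.
Proof.
move=> le_pq; set i := widen_ord _ p; set j := lift ord0 q.
have lift_iq : lift i q = j by apply: val_inj; rewrite /= /bump; lia.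
have lift_jp : lift j p = i by apply: val_inj; rewrite /= /bump; lia.
have lift2 k : lift j (lift p k) = lift i (lift q k).
  by apply: val_inj => /=; rewrite /bump; lia.
have [/andP[/eqP face_ww' let_ww']|not_pivot] := boolP (pivot _ _ _ _).
  have face_ww'_letter k : letter w' (lift q k) = letter w (lift p k).
    by rewrite -!letter_face face_ww'.
  have [|u uw' u_i] := @insert_letter _ w' i (letter w p).
    move=> k; case: (unliftP q k) => [k' ->|-> //].
    by rewrite face_ww'_letter (inj_eq (@letter_inj _ _)) eq_sym neq_lift.
  rewrite /= -(cards1 u); apply: eq_card => v; rewrite !inE.
  apply/andP/eqP => [[/eqP vw' /eqP vw]|->].
    apply: (@face_eq _ _ _ i); first by rewrite vw' uw'.
    by rewrite u_i -vw letter_face lift_jp.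
  rewrite uw'; split=> //; apply/eqP/eq_word => k; rewrite letter_face.
  case: (unliftP p k) => [k' ->|->]; last by rewrite lift_jp.
  by rewrite lift2 -letter_face uw'.
apply/eqP; rewrite cards_eq0; apply/eqP/setP => u; rewrite !inE.
apply: contraNF not_pivot => /andP[/eqP <- /eqP <-].
rewrite /pivot !letter_face lift_iq lift_jp; apply/andP; split.
  by apply/eqP/eq_word => k; rewrite !letter_face lift2.
by rewrite (inj_eq (@letter_inj _ _)) -lift_jp neq_lift.
Qed.

End Words.

(** * The commuting actions on positions and on letters *)

Section Actions.
Variables (n r : nat).
Implicit Type w : inj_word n r.

Definition posact (s : {perm 'I_r}) w : inj_word n r :=
  mkword (inj_comp (@letter_inj _ _ w) (@perm_inj _ s)).

Definition letact (g : {perm 'I_n}) w : inj_word n r :=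
  mkword (inj_comp (@perm_inj _ g) (@letter_inj _ _ w)).

Lemma letter_posact s w k : letter (posact s w) k = letter w (s k).
Proof. exact: letter_mkword. Qed.

Lemma letter_letact g w k : letter (letact g w) k = g (letter w k).
Proof. exact: letter_mkword. Qed.

Lemma posact1 w : posact 1 w = w.
Proof. by apply: eq_word => k; rewrite letter_posact perm1. Qed.

Lemma letact1 w : letact 1 w = w.
Proof. by apply: eq_word => k; rewrite letter_letact perm1. Qed.

Lemma posactM s t w : posact (s * t) w = posact s (posact t w).
Proof. by apply: eq_word => k; rewrite !letter_posact permM. Qed.

Lemma letactM g h w : letact (g * h) w = letact h (letact g w).
Proof. by apply: eq_word => k; rewrite !letter_letact permM. Qed.

Lemma letact_posact g s w : letact g (posact s w) = posact s (letact g w).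
Proof.
by apply: eq_word => k; rewrite !(letter_letact, letter_posact).
Qed.

End Actions.

(** * Entries of the Laplacian and the cancellation of off-diagonal replacements *)

Section LaplacianEntries.
Variables (K : comNzRingType) (n r : nat).
Implicit Types w : inj_word n r.+1.

Lemma sum_ord_lt (V : nmodType) m (G : 'I_m.+1 -> 'I_m.+1 -> V) :
  \sum_(i < m.+1) \sum_(j < m.+1 | (i < j)%N) G i j =
  \sum_(p < m) \sum_(q < m | (p <= q)%N) G (widen_ord (leqnSn _) p) (lift ord0 q).
Proof.
rewrite big_ord_recr /= [X in _ + X]big_pred0 => [|j]; last first.
  by rewrite ltnNge -ltnS ltn_ord.
rewrite addr0; apply: eq_bigr => p _.
by rewrite big_mkcond big_ord_recl /= add0r -big_mkcond.
Qed.

Lemma up_down_sum w' w :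
  \sum_(v : inj_word n r)
     bdry_coef K (val (val w')) (val (val v)) * bdry_coef K (val (val w)) (val (val v))
  = \sum_(i < r.+1) \sum_(j < r.+1) (-1) ^+ (i + j) * (face w' i == face w j)%:R.
Proof.
under eq_bigr => v _ do rewrite !bdry_coefE mulr_suml.
rewrite exchange_big; apply: eq_bigr => i _ /=.
under eq_bigr => v _ do rewrite mulr_sumr.
rewrite exchange_big; apply: eq_bigr => j _ /=.
rewrite -(sum_eq_indicator (fun v => (-1) ^+ (i + j) * (v == face w j)%:R) (face w' i)).
by apply: eq_bigr => v _; rewrite exprD -[face w' i == v]eq_sym [face w j == v]eq_sym; ring.
Qed.

Lemma down_up_sum m (w' w : inj_word n m) :
  \sum_(u : inj_word n m.+1)
     bdry_coef K (val (val u)) (val (val w')) * bdry_coef K (val (val u)) (val (val w))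
  = \sum_(i < m.+1) \sum_(j < m.+1) (-1) ^+ (i + j)
      * #|[set u | (face u i == w') && (face u j == w)]|%:R.
Proof.
under eq_bigr => u _ do rewrite !bdry_coefE mulr_suml.
rewrite exchange_big; apply: eq_bigr => i _ /=.
under eq_bigr => u _ do rewrite mulr_sumr.
rewrite exchange_big; apply: eq_bigr => j _ /=.
rewrite -sum1_card natr_sum mulr_sumr [RHS]big_mkcond.
apply: eq_bigr => u _; rewrite inE exprD.
by case: eqP; case: eqP => _ _ /=; ring.
Qed.

Lemma card_face_diag m (w' w : inj_word n m) (i : 'I_m.+1) :
  #|[set u | (face u i == w') && (face u i == w)]| = ((w' == w) * (n - m))%N.
Proof.
have [->|ne_ww'] := eqVneq w' w.
  by rewrite mul1n -(card_face_fiber w i); apply: eq_card => u; rewrite !inE andbb.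
apply/eqP; rewrite cards_eq0; apply/eqP/setP => u; rewrite !inE.
by apply: contraNF ne_ww' => /andP[/eqP <- /eqP <-].
Qed.

(** Equal faces leave two cases: the deleted letters differ, or they agree and [w'] is [w] with the
    letter at [q] moved to [p]. *)
Lemma face_pivot_or_shift w' w p q :
  (face w' p == face w q)%:R =
  (pivot w' w p q)%:R + (w' == posact (lift_perm p q 1) w)%:R :> K.
Proof.
suff -> : (w' == posact (lift_perm p q 1) w) =
    (face w' p == face w q) && (letter w' p == letter w q).
  by rewrite /pivot; case: eqP => _; case: eqP => _ /=; ring.
apply/eqP/andP => [->|[/eqP faceE /eqP letE]].
  rewrite letter_posact lift_perm_id; split=> //; apply/eqP/eq_word => k.
  by rewrite !letter_face letter_posact lift_perm_lift perm1.
apply: (@face_eq _ _ _ _ p); last by rewrite letter_posact lift_perm_id.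
rewrite faceE; apply/eq_word => k.
by rewrite !letter_face letter_posact lift_perm_lift perm1.
Qed.

(** In the second sum the pairs i = j give the scalar term. The pairs i < j and j < i become pivots
    over [p <= q], with sign reversed by the shift j = q + 1. Against the pivots of the first sum
    those with p and q distinct cancel; each diagonal one occurs once positively and twice
    negatively. *)
Lemma laplacian_entry w' w :
  \sum_(v : inj_word n r)
     bdry_coef K (val (val w')) (val (val v)) * bdry_coef K (val (val w)) (val (val v))
  + \sum_(u : inj_word n r.+2)
     bdry_coef K (val (val u)) (val (val w')) * bdry_coef K (val (val u)) (val (val w))
  = (w' == w)%:R * (r.+2 * (n - r.+1))%:R
    + \sum_(i < r.+1) \sum_(j < r.+1) (-1) ^+ (i + j) * (w' == posact (lift_perm i j 1) w)%:R
    - \sum_p (pivot w' w p p)%:R.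
Proof.
rewrite up_down_sum down_up_sum.
pose N (i j : 'I_r.+2) : K :=
  (-1) ^+ (i + j) * #|[set u | (face u i == w') && (face u j == w)]|%:R.
pose H (p q : 'I_r.+1) : K := (-1) ^+ (p + q) * (pivot w' w p q)%:R.
have trichotomy m (G : 'I_m -> 'I_m -> K) : \sum_i \sum_j G i j =
    \sum_i G i i + \sum_(i < m) \sum_(j < m | (i < j)%N) G i j
    + \sum_(i < m) \sum_(j < m | (i < j)%N) G j i.
  have -> : \sum_(i < m) \sum_(j < m | (i < j)%N) G j i =
      \sum_(i < m) \sum_(j < m | (j < i)%N) G i j.
    by rewrite (exchange_big_dep predT).
  rewrite -!big_split; apply: eq_bigr => i _ /=.
  rewrite (bigD1 i) //= -addrA; congr (_ + _).
  rewrite (bigID (fun j : 'I_m => i < j)%N) /=; congr (_ + _).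
    by apply: eq_bigl => j; rewrite -val_eqE /=; case: ltngtP.
  by apply: eq_bigl => j; rewrite -val_eqE /=; case: ltngtP.
have diag : \sum_i N i i = (w' == w)%:R * (r.+2 * (n - r.+1))%:R.
  under eq_bigr => i _ do rewrite /N card_face_diag addnn -signr_odd odd_double mul1r.
  by rewrite sumr_const card_ord -mulr_natl !natrM; ring.
have below : \sum_(i < r.+2) \sum_(j < r.+2 | (i < j)%N) N i j =
    - \sum_(p < r.+1) \sum_(q < r.+1 | (p <= q)%N) H q p.
  rewrite sum_ord_lt -sumrN; apply: eq_bigr => p _.
  rewrite -sumrN; apply: eq_bigr => q le_pq.
  by rewrite /N card_face_pair // /H /= addnS exprS mulN1r mulNr addnC.
have above : \sum_(i < r.+2) \sum_(j < r.+2 | (i < j)%N) N j i =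
    - \sum_(p < r.+1) \sum_(q < r.+1 | (p <= q)%N) H p q.
  rewrite (sum_ord_lt (fun i j => N j i)) -sumrN; apply: eq_bigr => p _.
  rewrite -sumrN; apply: eq_bigr => q le_pq.
  rewrite /N /H (pivotC w' w) -card_face_pair // addnC /= addnS exprS mulN1r mulNr.
  congr (- (_ * _%:R)); apply: eq_card => u; rewrite !inE andbC //.
have halves (G : 'I_r.+1 -> 'I_r.+1 -> K) :
    \sum_(p < r.+1) \sum_(q < r.+1 | (p <= q)%N) G p q =
    \sum_p G p p + \sum_(p < r.+1) \sum_(q < r.+1 | (p < q)%N) G p q.
  rewrite -big_split; apply: eq_bigr => p _ /=; rewrite (bigD1 p) //=.
  congr (_ + _); apply: eq_bigl => q.
  by rewrite -val_eqE /=; case: ltngtP.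
have diagH : \sum_p (pivot w' w p p)%:R = \sum_p H p p.
  by apply: eq_bigr => p _; rewrite /H addnn -signr_odd odd_double mul1r.
have split1 :
   \sum_(i < r.+1) \sum_(j < r.+1) (-1) ^+ (i + j) * (face w' i == face w j)%:R =
   \sum_i \sum_j H i j +
   \sum_(i < r.+1) \sum_(j < r.+1) (-1) ^+ (i + j) * (w' == posact (lift_perm i j 1) w)%:R :> K.
  rewrite -big_split; apply: eq_bigr => i _; rewrite -big_split; apply: eq_bigr => j _ /=.
  by rewrite face_pivot_or_shift mulrDr.
rewrite split1 (trichotomy _ N) (trichotomy _ H) diag below above diagH.
rewrite (halves H) (halves (fun p q => H q p)); ring.
Qed.

End LaplacianEntries.

(** * Transpositions of letters, sorted by how many of the two letters occur in the word *)

Section Transpositions.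
Variables (K : comNzRingType) (n r : nat).
Implicit Types w : inj_word n r.+1.

Let outside w := ~: (letter w @: setT).

Lemma outsideP w a : reflect (forall k, letter w k != a) (a \in outside w).
Proof.
rewrite inE; apply: (iffP idP) => [out_a k|out_a].
  by apply: contraNneq out_a => <-; apply: imset_f.
by apply/imsetP => -[k _ ak]; have := out_a k; rewrite ak eqxx.
Qed.

Lemma card_outside w : #|outside w| = (n - r.+1)%N.
Proof.
by rewrite /outside cardsCs setCK card_imset ?cardsT ?card_ord //; apply: letter_inj.
Qed.

Lemma sum_letters w (V : nmodType) (F : 'I_n -> V) :
  \sum_a F a = \sum_k F (letter w k) + \sum_(a in outside w) F a.
Proof.
rewrite (bigID (mem (letter w @: setT))) /= big_imset /=; last first.
  by move=> k l _ _; apply: letter_inj.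
congr (_ + _); first by apply: eq_bigl => k; rewrite inE.
by apply: eq_bigl => a; rewrite inE.
Qed.

Lemma letact_tperm_inside w k l :
  letact (tperm (letter w k) (letter w l)) w = posact (tperm k l) w.
Proof.
apply: eq_word => j; rewrite letter_letact letter_posact.
by rewrite inj_tperm //; apply: letter_inj.
Qed.

Lemma letact_tperm_outside w a b :
  a \in outside w -> b \in outside w -> letact (tperm a b) w = w.
Proof.
move=> /outsideP a_out /outsideP b_out; apply: eq_word => k.
by rewrite letter_letact tpermD // eq_sym.
Qed.

Lemma letact_tperm_replace w w' k b : b \in outside w ->
  (w' == letact (tperm (letter w k) b) w) =
  (face w' k == face w k) && (b == letter w' k).
Proof.
move=> /outsideP b_out.
have facek : face (letact (tperm (letter w k) b) w) k = face w k.
  apply: eq_word => j; rewrite !letter_face letter_letact tpermD //.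
    by rewrite (inj_eq (@letter_inj _ _ _)) neq_lift.
  by rewrite eq_sym.
have letk : letter (letact (tperm (letter w k) b) w) k = b.
  by rewrite letter_letact tpermL.
apply/eqP/andP => [->|[/eqP facew' /eqP bk]]; first by rewrite facek letk !eqxx.
by apply: (@face_eq _ _ _ _ k); rewrite ?facek ?letk.
Qed.

(** When the faces at [k] agree, the letter of [w'] at [k] avoids the other letters of [w], so it is
    outside [w] as soon as it differs from the one replaced; only this [b] contributes. *)
Lemma sum_replacements w w' k :
  \sum_(b in outside w) (w' == letact (tperm (letter w k) b) w)%:R =
  (pivot w' w k k)%:R :> K.
Proof.
have -> : pivot w' w k k = (face w' k == face w k) && (letter w' k \in outside w).
  rewrite /pivot; case: eqP => //= faceE; apply/idP/outsideP => [ne_k j|]; last first.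
    by rewrite eq_sym; apply.
  case: (unliftP k j) => [j' ->|->]; last by rewrite eq_sym.
  by rewrite -letter_face -faceE letter_face (inj_eq (@letter_inj _ _ _)) eq_sym neq_lift.
under eq_bigr => b b_out do rewrite letact_tperm_replace //.
case: eqP => _ /=; last by rewrite big1.
have [k_out|k_in] := boolP (_ \in _).
  rewrite (bigD1 (letter w' k)) //= eqxx big1 ?addr0 // => b /andP[_ /negPf -> //].
by rewrite big1 // => b b_out; case: eqP b_out k_in => // -> ->.
Qed.

(** Two letters of [w] give a transposition of positions; one letter gives a replacement, counted in
    both orders; two letters outside fix [w]. *)
Lemma tperm_letters w w' :
  \sum_(ab : 'I_n * 'I_n | ab.1 != ab.2) (w' == letact (tperm ab.1 ab.2) w)%:R =
  \sum_(kl : 'I_r.+1 * 'I_r.+1 | kl.1 != kl.2) (w' == posact (tperm kl.1 kl.2) w)%:R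
  + (\sum_k (pivot w' w k k)%:R) *+ 2
  + ((n - r.+1) * (n - r.+1).-1)%:R * (w' == w)%:R :> K.
Proof.
pose Y a b : K := if a != b then (w' == letact (tperm a b) w)%:R else 0.
have -> : \sum_(ab : 'I_n * 'I_n | ab.1 != ab.2) (w' == letact (tperm ab.1 ab.2) w)%:R =
    \sum_a \sum_b Y a b by rewrite pair_big big_mkcond.
have inside_inside : \sum_(kl : 'I_r.+1 * 'I_r.+1 | kl.1 != kl.2)
     (w' == posact (tperm kl.1 kl.2) w)%:R = \sum_k \sum_l Y (letter w k) (letter w l).
  rewrite pair_big big_mkcond; apply: eq_bigr => -[k l] _ /=.
  by rewrite /Y (inj_eq (@letter_inj _ _ _)) letact_tperm_inside.
have inside_outside : \sum_k \sum_(b in outside w) Y (letter w k) b =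
    \sum_k (pivot w' w k k)%:R.
  apply: eq_bigr => k _; rewrite -sum_replacements; apply: eq_bigr => b /outsideP b_out.
  by rewrite /Y b_out.
have outside_inside : \sum_(a in outside w) \sum_k Y a (letter w k) =
    \sum_k (pivot w' w k k)%:R.
  rewrite exchange_big -inside_outside; apply: eq_bigr => k _; apply: eq_bigr => a _.
  by rewrite /Y eq_sym tpermC.
have outside_outside : \sum_(a in outside w) \sum_(b in outside w) Y a b =
    ((n - r.+1) * (n - r.+1).-1)%:R * (w' == w)%:R.
  rewrite -(card_outside w) natrM -mulrA mulr_natl -sumr_const.
  apply: eq_bigr => a a_out; rewrite (bigD1 a) //= /Y eqxx add0r.
  rewrite (eq_bigr (fun _ => (w' == w)%:R)) => [|b /andP[b_out ba]]; last first.
    by rewrite eq_sym ba letact_tperm_outside.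
  rewrite sumr_const (cardD1 a (mem (outside w))) a_out /= mulr_natl.
  by congr (_ *+ _); apply: eq_card => b; rewrite [LHS]unfold_in !inE andbC.
rewrite (sum_letters w (fun a => \sum_b Y a b)).
under eq_bigr => k _ do rewrite (sum_letters w (Y _)).
under [X in _ + X]eq_bigr => a _ do rewrite (sum_letters w (Y _)).
rewrite !big_split /= inside_inside inside_outside outside_inside outside_outside.
by rewrite mulr2n !addrA.
Qed.

End Transpositions.

(** * The random-to-random element and its signed action on words *)

Section RandomToRandom.
Variable C : numClosedFieldType.

(** Both maps send v to u and are increasing on the remaining points. *)
Lemma r2r_cycleE r (u v x : 'I_r.+1) : r2r_cycle u v x = lift_perm v u 1 x.
Proof.
rewrite /r2r_cycle; case: (unliftP v x) => [k ->|->]; last first.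
  by rewrite eqxx lift_perm_id.
rewrite eq_sym (negPf (neq_lift _ _)) lift_perm_lift perm1 /= /bump.
case: ifP => [|not_up]; first by lia.
case: ifP; lia.
Qed.

(** [upsilon_coef] is a multiplicity, since distinct pairs may give the same permutation; the sum is
    unfolded back to pairs. *)
Lemma sum_upsilon_coef r (F : {perm 'I_r.+1} -> C) :
  \sum_s upsilon_coef C s * F s =
  \sum_(u < r.+1) \sum_(v < r.+1) F (lift_perm v u 1).
Proof.
have coefE s : upsilon_coef C s = \sum_u \sum_v (s == lift_perm v u 1)%:R.
  rewrite pair_big /upsilon_coef -sum1_card natr_sum big_mkcond.
  apply: eq_bigr => -[u v] _; rewrite inE /=.
  have -> : [forall x, val (s x) == r2r_cycle u v x] = (s == lift_perm v u 1).
    apply/forallP/eqP => [sE|-> x]; last by rewrite r2r_cycleE.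
    by apply/permP => x; apply: val_inj; rewrite (eqP (sE x)) r2r_cycleE.
  by case: (s == _).
under eq_bigr => s _ do rewrite coefE mulr_suml.
rewrite exchange_big; apply: eq_bigr => u _ /=.
under eq_bigr => s _ do rewrite mulr_suml.
rewrite exchange_big; apply: eq_bigr => v _ /=.
rewrite -[RHS](sum_eq_indicator F); apply: eq_bigr => s _; exact: mulrC.
Qed.

Lemma upsilon_left_eigenvalue r (h : {perm 'I_r} -> C) (a : C) :
  (forall tau, \sum_s upsilon_coef C s * h (s * tau)%g = a * h tau) ->
  (exists s, h s != 0) -> eigenvalue (upsilon_left C r) a.
Proof.
move=> hE h_n0; apply/fmx_eigenvalueP; exists h => // tau.
rewrite -hE (reindex_inj (mulIg tau)); apply: eq_bigr => s _.
by rewrite mulgK mulrC.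
Qed.

(** The factor (-1)^(i+j) of a shift term in [laplacian_entry] is the signature of
    [lift_perm i j 1], whence the twist by the sign character. *)
Definition signed_r2r n r : 'M[C]_#|{: inj_word n r}| :=
  \sum_(s : {perm 'I_r}) ((-1) ^+ s * upsilon_coef C s) *: funmx C (posact s).

(* If [f] is an eigenfunction with [f w <> 0], then [s |-> sgn(s) f (posact s w)] is an
   eigenvector of [upsilon_left]. *)
Lemma signed_r2r_integral n r :
  all_eigs_integral (upsilon_left C r) -> all_eigs_integral (signed_r2r n r).
Proof.
move=> intU a.
have -> : signed_r2r n r = fmx (fun x y : inj_word n r =>
    \sum_(s : {perm 'I_r}) ((-1) ^+ s * upsilon_coef C s) * (x == posact s y)%:R).
  by apply/matrixP=> i j; rewrite summxE mxE; apply: eq_bigr => s _; rewrite !mxE.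
case/fmx_eigenvalueP=> f fE [w fw_n0]; apply: intU.
apply: (@upsilon_left_eigenvalue _ (fun s => (-1) ^+ s * f (posact s w))) => [tau|].
  rewrite mulrCA -fE.
  under [in RHS]eq_bigr => x _ do rewrite mulr_sumr.
  rewrite exchange_big mulr_sumr; apply: eq_bigr => s _ /=.
  rewrite posactM odd_permM signr_addb -(sum_eq_indicator f (posact s (posact tau w))).
  rewrite !mulr_sumr; apply: eq_bigr => x _.
  move: ((-1) ^+ s) ((-1) ^+ tau) (upsilon_coef C s) (f x) (_%:R) => ? ? ? ? ?; ring.
by exists 1%g; rewrite odd_perm1 mul1r posact1.
Qed.

End RandomToRandom.

(** * Integrality and commutation of the summands *)

Section Decomposition.
Variables (C : numClosedFieldType) (n r : nat).

Let position_rep (s : {perm 'I_r}) : 'M[int]_#|{: inj_word n r}| := funmx int (posact s).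
(** [letact] reverses products, so the inverse is needed for a homomorphism; transpositions are
    unaffected by it. *)
Let letter_rep (g : {perm 'I_n}) : 'M[int]_#|{: inj_word n r}| := funmx int (letact g^-1).

Let position_rep1 : position_rep 1%g = 1%:M.
Proof. by apply: funmx_id => w; rewrite posact1. Qed.

Let letter_rep1 : letter_rep 1%g = 1%:M.
Proof. by apply: funmx_id => w; rewrite invg1 letact1. Qed.

Let position_repM s t : position_rep (s * t)%g = position_rep s *m position_rep t.
Proof. by rewrite -funmx_comp; apply: eq_funmx => w; rewrite /= posactM. Qed.

Let letter_repM g h : letter_rep (g * h)%g = letter_rep g *m letter_rep h.
Proof. by rewrite -funmx_comp; apply: eq_funmx => w; rewrite /= invMg letactM. Qed.

Let reps_commute g s : letter_rep g *m position_rep s = position_rep s *m letter_rep g.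
Proof. by rewrite -!funmx_comp; apply: eq_funmx => w; rewrite /= letact_posact. Qed.

Definition position_tperms : 'M[C]_#|{: inj_word n r}| :=
  map_mx intr (tperm_sum position_rep).

Definition letter_tperms : 'M[C]_#|{: inj_word n r}| :=
  map_mx intr (tperm_sum letter_rep).

Lemma position_tperms_integral : all_eigs_integral position_tperms.
Proof. exact: tperm_sum_integral. Qed.

Lemma letter_tperms_integral : all_eigs_integral letter_tperms.
Proof. exact: tperm_sum_integral. Qed.

Lemma position_tperms_r2r :
  signed_r2r C n r *m position_tperms = position_tperms *m signed_r2r C n r.
Proof.
rewrite mulmx_suml mulmx_sumr; apply: eq_bigr => s _.
rewrite -scalemxAl -scalemxAr -(map_funmx _ C) -!map_mxM.
by rewrite [funmx _ _ *m _]tperm_sum_central.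
Qed.

Lemma letter_tperms_commute (s : {perm 'I_r}) :
  funmx C (posact s) *m letter_tperms = letter_tperms *m funmx C (posact s).
Proof.
rewrite -(map_funmx _ C) -!map_mxM; congr map_mx.
rewrite /tperm_sum mulmx_sumr mulmx_suml; apply: eq_bigr => ab _.
exact/esym/reps_commute.
Qed.

Lemma letter_tperms_r2r :
  signed_r2r C n r *m letter_tperms = letter_tperms *m signed_r2r C n r.
Proof.
rewrite mulmx_suml mulmx_sumr; apply: eq_bigr => s _.
by rewrite -scalemxAl -scalemxAr letter_tperms_commute.
Qed.

Lemma letter_position_tperms :
  position_tperms *m letter_tperms = letter_tperms *m position_tperms.
Proof.
rewrite /position_tperms /tperm_sum raddf_sum mulmx_suml mulmx_sumr.
by apply: eq_bigr => ab _; rewrite /= /position_rep map_funmx letter_tperms_commute.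
Qed.

End Decomposition.

(** * The Laplacian as a combination of commuting operators *)

Lemma laplacianE (C : numClosedFieldType) (n r : nat) :
  laplacian C n r.+1 =
  (r.+2 * (n - r.+1) + 'C(n - r.+1, 2))%:R%:M + signed_r2r C n r.+1
  + position_tperms C n r.+1 - letter_tperms C n r.+1.
Proof.
apply/matrixP=> i j; set w' := enum_val i; set w := enum_val j.
have r2rE : signed_r2r C n r.+1 i j =
    \sum_(p < r.+1) \sum_(q < r.+1) (-1) ^+ (p + q)
      * (w' == posact (lift_perm p q 1) w)%:R.
  pose F s : C := (-1) ^+ (s : {perm 'I_r.+1}) * (w' == posact s w)%:R.
  transitivity (\sum_s upsilon_coef C s * F s).
    rewrite summxE; apply: eq_bigr => s _; rewrite !mxE /F.
    by rewrite mulrCA mulrA.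
  rewrite sum_upsilon_coef exchange_big; apply: eq_bigr => p _; apply: eq_bigr => q _.
  by rewrite /F odd_lift_perm odd_perm1 addbF -oddD signr_odd.
have posE : position_tperms C n r.+1 i j *+ 2 =
    \sum_(kl : 'I_r.+1 * 'I_r.+1 | kl.1 != kl.2) (w' == posact (tperm kl.1 kl.2) w)%:R.
  rewrite (sum_tperm_pairs (fun s => (w' == posact s w)%:R)); congr (_ *+ 2).
  by rewrite mxE summxE raddf_sum; apply: eq_bigr => s _; rewrite mxE /= rmorph_nat.
have letE : letter_tperms C n r.+1 i j *+ 2 =
    \sum_(ab : 'I_n * 'I_n | ab.1 != ab.2) (w' == letact (tperm ab.1 ab.2) w)%:R.
  rewrite (sum_tperm_pairs (fun g => (w' == letact g w)%:R)); congr (_ *+ 2).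
  rewrite mxE summxE raddf_sum; apply: eq_bigr => ab _.
  by rewrite mxE /= tpermV rmorph_nat.
have lapE : laplacian C n r.+1 i j = _ := etrans (mxE _ _ _ _) (laplacian_entry C w' w).
have binE : ((n - r.+1) * (n - r.+1).-1)%:R = 'C(n - r.+1, 2)%:R *+ 2 :> C.
  by rewrite -mulrnA -[2%N]/(2`!) bin_ffact ffactnS ffactn1.
(* Halving the identity over ordered pairs expresses the sum of diagonal pivots through the two
   transposition sums and a binomial scalar. *)
have lettersE : letter_tperms C n r.+1 i j = position_tperms C n r.+1 i j
    + \sum_k (pivot w' w k k)%:R + 'C(n - r.+1, 2)%:R * (w' == w)%:R.
  apply: (@pmulrnI _ 2) => //; rewrite letE tperm_letters binE -posE.
  by rewrite !mulrnDl [_ *+ 2 * _]mulrnAl.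
rewrite lapE -r2rE; move: lettersE.
move: (signed_r2r C n r.+1) (position_tperms C n r.+1) (letter_tperms C n r.+1) => R P L.
rewrite !mxE => ->; rewrite -(inj_eq enum_val_inj) -/w' -/w natrD.
move: (R i j) (P i j) (\sum_k _) => x y z.
by case: (w' == w); rewrite ?mulr1n ?mulr0n; ring.
Qed.

Lemma laplacian0E (C : numClosedFieldType) (n : nat) :
  laplacian C n 0 = n%:R%:M.
Proof.
(* Since [0.-1] is [0], the first sum runs over the empty word; it vanishes because the boundary of
   the empty word has no terms. *)
apply/matrixP=> i j; rewrite !mxE big1 ?add0r => [|v _]; last first.
  by rewrite /bdry_coef size_tuple big_ord0 mul0r.
rewrite down_up_sum !big_ord1 card_face_diag subn0 addn0 expr0 mul1r.
by rewrite (inj_eq enum_val_inj) natrM mulr_natl.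
Qed.

Theorem theorem3p3 (C : numClosedFieldType) (n r : nat) :
  (r < n)%N ->
  all_eigs_integral (upsilon_left C r) ->
  all_eigs_integral (laplacian C n r).
Proof.
case: r => [|r] _ intU.
  by rewrite laplacian0E; apply/all_eigs_integral_scalar/is_integer_nat.
rewrite laplacianE.
(* The summands are split off from the right, each commuting with the sum of those before it. *)
apply: all_eigs_integralD.
- rewrite mulmxN mulNmx !mulmxDl !mulmxDr scalar_mxC.
  by rewrite letter_tperms_r2r letter_position_tperms.
- apply: all_eigs_integralD.
  + by rewrite mulmxDl mulmxDr scalar_mxC position_tperms_r2r.
  + apply: all_eigs_integralD; first exact/esym/scalar_mxC.
      exact/all_eigs_integral_scalar/is_integer_nat.
    exact: signed_r2r_integral.
  + exact: position_tperms_integral.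
- exact/all_eigs_integralN/letter_tperms_integral.
Qed.
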